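(* Let $N,\widetilde N\in\mathbb{C}^{n\times n}$. If for every pair of unitary matrices $U,V$, $U\widetilde NV$ is a standard $\varepsilon/2$-approximation of $UNV$ with respect to degree matrix $I$, then $\widetilde N$ is an $\varepsilon$-normalized SV approximation of $N$. Moreover, if $\widetilde N$ is an $\varepsilon$-normalized SV approximation of $N$, then for every pair of matrices $U,V\in\mathbb{C}^{n\times n}$ with $\|U\|\le1$, $\|V\|\le1$, $U\widetilde NV$ is an $\varepsilon$-normalized SV approximation of $UNV$, and hence $U\widetilde NV$ is a standard $\varepsilon$-approximation of $UNV$ with respect to degree matrix $I$.
   Context: $\|\cdot\|$ is the spectral norm, $M^*$ the conjugate transpose, $S_M=(M+M^* )/2$. For $X,\widetilde X\in\mathbb{C}^{n\times n}$ and PSD $D$, $\widetilde X$ is a standard $\delta$-approximation of $X$ with respect to degree matrix $D$ if $E=D-S_X$ is PSD and $|x^*(\widetilde X-X)y|\le\frac{\delta}{2}(x^*Ex+y^*Ey)$ for all $x,y\in\mathbb{C}^n$. $\widetilde N$ is an $\varepsilon$-normalized SV approximation of $N$ if $I-NN^*$ and $I-N^*N$ are PSD and for all $x,y$: $|x^*(\widetilde N-N)y|\le\frac{\varepsilon}{4}\big(x^*(I-NN^* )x+y^*(I-N^*N)y\big)$. *)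

(* Defs.v *)
(* The complex numbers are [R[i]], for an arbitrary [R : realType]. *)
From mathcomp Require Import all_boot all_order all_algebra.
From mathcomp Require Import complex.
From mathcomp Require Import classical_sets reals.

Set Implicit Arguments.
Unset Strict Implicit.
Unset Printing Implicit Defensive.

Import Order.TTheory GRing.Theory Num.Theory.
Local Open Scope ring_scope.
Local Open Scope complex_scope.
Local Open Scope sesquilinear_scope.

(* [x^* A y] as a scalar. *)
Definition sform (R : realType) (n : nat) (A : 'M[R[i]]_n)
    (x y : 'cV[R[i]]_n) : R[i] :=
  (x ^t* *m A *m y) 0 0.

(* [0 <= z] in [R[i]] means that [z] is real and nonnegative. *)
Definition psdmx (R : realType) (n : nat) (A : 'M[R[i]]_n) : Prop :=
  A \is hermsymmx /\ forall x : 'cV[R[i]]_n, 0 <= sform A x x.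

Definition vnorm2 (R : realType) (n : nat) (x : 'cV[R[i]]_n) : R :=
  Num.sqrt (\sum_(i < n) ComplexField.Normc.normc (x i 0) ^+ 2).

(* The operator norm induced by the Euclidean norm. The closed unit ball is
   used rather than the unit sphere so that the set is nonempty for [n = 0]. *)
Definition spectral_norm (R : realType) (n : nat) (A : 'M[R[i]]_n) : R :=
  sup [set vnorm2 (A *m x) | x in [set x : 'cV[R[i]]_n | vnorm2 x <= 1]]%classic.

Definition symmetrization (R : realType) (n : nat) (M : 'M[R[i]]_n) :
    'M[R[i]]_n :=
  2^-1 *: (M + M ^t*).

(* The inequalities below are in [R[i]]; since the matrices on the right are
   PSD, both sides are real. *)
Definition standard_approx (R : realType) (n : nat) (delta : R)
    (D Xt X : 'M[R[i]]_n) : Prop :=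
  let E := D - symmetrization X in
  [/\ psdmx D,
      psdmx E
    & forall x y : 'cV[R[i]]_n,
        `|sform (Xt - X) x y| <= (delta / 2)%:C * (sform E x x + sform E y y)].

Definition normalized_SV_approx (R : realType) (n : nat) (eps : R)
    (Nt N : 'M[R[i]]_n) : Prop :=
  [/\ psdmx (1%:M - N *m N ^t*),
      psdmx (1%:M - N ^t* *m N)
    & forall x y : 'cV[R[i]]_n,
        `|sform (Nt - N) x y| <=
          (eps / 4)%:C * (sform (1%:M - N *m N ^t*) x x +
                          sform (1%:M - N ^t* *m N) y y)].

(* Main.v *)
Require Import Defs.
From mathcomp Require Import all_boot all_order all_algebra.
From mathcomp Require Import complex ring.
From mathcomp Require Import classical_sets reals.

Import Order.TTheory GRing.Theory Num.Theory.
Local Open Scope ring_scope.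
Local Open Scope sesquilinear_scope.

(* For the first claim, choose for [U] and [V] the unitary factors of a singular
   value decomposition, so that [U N V = Sigma] is diagonal and nonnegative.  The
   error matrix of the standard approximation is then [I - Sigma], whose positivity
   gives [Sigma <= I], hence [I - Sigma <= I - Sigma^2]; undoing the change of basis
   turns [I - Sigma^2] into [I - N N^*] and [I - N^* N].

   For the converse, [I - (UNV)(UNV)^*] is the sum of [U (I - N N^* ) U^*] and of
   the positive semidefinite matrices [I - U U^*] and
   [U N (I - V V^* ) N^* U^*], so the normalized bound for [N] at [U^* x] and [V y]
   implies the one for [UNV] at [x] and [y].  Finally
   [2 (I - S_N) - (I - N N^* ) = (I - N)(I - N)^*] is positive semidefinite, which
   compares the normalized error with the standard one. *)

(** * Unitary completion and the singular value decomposition *)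

Lemma hermsymmxP {C : numClosedFieldType} {n : nat} {A : 'M[C]_n} :
  reflect (A ^t* = A) (A \is hermsymmx).
Proof.
by apply: (iffP (is_hermitianmxP _ _ _)); rewrite expr0 scale1r => /esym.
Qed.

Lemma trmxC_mul {C : numClosedFieldType} {m n p : nat}
  (A : 'M[C]_(m, n)) (B : 'M[C]_(n, p)) : (A *m B) ^t* = B ^t* *m A ^t*.
Proof. by rewrite trmx_mul map_mxM. Qed.

(* Each new row is a kernel vector of the matrix in which the rows outside [S]
   are zeroed: that matrix has a zero row, so its determinant vanishes. *)
Lemma orthonormal_rows_extend {C : numClosedFieldType} {n : nat}
    (A : 'M[C]_n) (S : {set 'I_n}) :
  {in S &, forall i j, (A *m A ^t*) i j = (i == j)%:R} ->
  exists2 W : 'M[C]_n, W \is unitarymx & {in S, forall i, row i W = row i A}.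
Proof.
(* Induction on the number of rows outside [S], adjoining one row at a time. *)
have [k] := ubnP #|~: S|; elim: k A S => // k IHk A S leSk orthoA.
case: (pickP [pred i | i \notin S]) => [i /= iS | S_full]; last first.
  exists A => //; apply/unitarymxP/matrixP => i j; rewrite [RHS]mxE.
  by apply: orthoA; apply/negbFE/S_full.
pose B : 'M[C]_n := \matrix_(j, l) if j \in S then A j l else 0.
have detB : \det (B ^t*) == 0.
  rewrite det_map_mx det_tr (expand_det_row _ i) big1 ?rmorph0 ?eqxx // => j _.
  by rewrite mxE (negPf iS) mul0r.
have [v v_neq0 vB] := det0P detB.
have vv_gt0 : 0 < \sum_l v 0 l * (v 0 l)^*.
  by have := dotmx_is_dotmx v_neq0; rewrite dotmxE mxE; congr (_ < _);
    apply: eq_bigr => l _; rewrite !mxE.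
set c := \sum_l _ in vv_gt0.
have vA j : j \in S -> \sum_l v 0 l * (A j l)^* = 0.
  move=> jS; have /rowP/(_ j) := vB; rewrite !mxE => E; rewrite -[RHS]E.
  by apply: eq_bigr => l _; rewrite !mxE jS.
have Av j : j \in S -> \sum_l A j l * (v 0 l)^* = 0.
  move=> /vA /(congr1 Num.conj); rewrite rmorph0 rmorph_sum => E; rewrite -[RHS]E.
  by apply: eq_bigr => l _; rewrite rmorphM /= conjCK mulrC.
(* [r] is the inverse length of [v]: the new row [r * v] has norm 1. *)
pose r := (sqrtC c)^-1.
have r_ge0 : 0 <= r by rewrite invr_ge0 sqrtC_ge0 ltW.
have conj_r : r^* = r by apply: geC0_conj.
pose A' : 'M[C]_n := \matrix_(j, l) if j == i then r * v 0 l else A j l.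
have [|j l|W unitW WA'] := IHk A' (i |: S).
- rewrite finset.setCU finset.setIC -finset.setDE.
  by rewrite (cardsD1 i) inE iS in leSk.
- rewrite !inE mxE; case: (j =P i) => [->|/eqP ji] /=; last move=> jS.
    move=> _; case: (l =P i) => [->|/eqP li] /=; last move=> lS.
      rewrite eqxx (eq_bigr (fun k => r * r * (v 0 k * (v 0 k)^*))); last first.
        by move=> q _; rewrite !mxE eqxx rmorphM /= conj_r mulrACA.
      by rewrite -mulr_sumr -expr2 exprVn sqrtCK mulVf ?gt_eqF.
    rewrite eq_sym (negPf li) (eq_bigr (fun k => r * (v 0 k * (A l k)^*))).
      by rewrite -mulr_sumr vA ?mulr0.
    by move=> q _; rewrite !mxE eqxx (negPf li) mulrA.
  case: (l =P i) => [->|/eqP li] /=; last move=> lS.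
    rewrite (negPf ji) (eq_bigr (fun k => r * (A j k * (v 0 k)^*))).
      by rewrite -mulr_sumr Av ?mulr0.
    by move=> q _; rewrite !mxE eqxx (negPf ji) rmorphM /= conj_r mulrCA.
  rewrite -orthoA // mxE; apply: eq_bigr => q _.
  by rewrite !mxE (negPf ji) (negPf li).
exists W => // j jS; rewrite WA' ?inE ?jS ?orbT //.
apply/rowP => l; rewrite !mxE ifN //.
by apply: contraNneq iS => <-.
Qed.

(** A unitary [P] diagonalizing [N *m N ^t*] makes the rows of [P *m N] pairwise orthogonal, with
    squared lengths [d]. Normalizing the nonzero rows and completing them to a unitary [W] gives
    [P *m N = diag_mx s *m W], so that [Q] is the adjoint of [W]. *)
Lemma singular_value_decomposition {C : numClosedFieldType} {n : nat}
    (N : 'M[C]_n) :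
  exists P Q : 'M[C]_n, exists s : 'rV[C]_n,
    [/\ P \is unitarymx, Q \is unitarymx, forall i, 0 <= s 0 i
      & P *m N *m Q = diag_mx s].
Proof.
have normal_NN : N *m N ^t* \is normalmx.
  by apply/hermitian_normalmx/hermsymmxP; rewrite trmxC_mul trmxCK.
set P := spectralmx (N *m N ^t*).
have unitP : P \is unitarymx by apply: spectral_unitarymx.
pose d := spectral_diag (N *m N ^t*).
have [M defM] : exists M, M = P *m N by exists (P *m N).
have MM : M *m M ^t* = diag_mx d.
  rewrite defM trmxC_mul mulmxA -(mulmxA P) (orthomx_spectralP normal_NN) -/P -/d.
  by rewrite !mulmxA mulmxV ?unitarymx_unit // mul1mx mulmxtVK.
have MMi i j : \sum_l M i l * (M j l)^* = d 0 i *+ (i == j).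
  have /matrixP/(_ i j) := MM; rewrite !mxE => <-.
  by apply: eq_bigr => l _; rewrite !mxE.
have d_ge0 i : 0 <= d 0 i.
  have := MMi i i; rewrite eqxx mulr1n => <-; apply: sumr_ge0 => l _.
  exact: mul_conjC_ge0.
have [s [s_ge0 s_sqr]] :
    exists s : 'rV[C]_n, (forall i, 0 <= s 0 i) /\ forall i, s 0 i ^+ 2 = d 0 i.
  by exists (\row_i sqrtC (d 0 i)); split=> i; rewrite mxE ?sqrtC_ge0 ?sqrtCK.
(* Since the inverse of 0 is 0, rows with [s 0 i = 0] become zero; only the other rows are claimed
   orthonormal. *)
pose A : 'M[C]_n := \matrix_(i, j) ((s 0 i)^-1 * M i j).
have [i j|W unitW WA] := @orthonormal_rows_extend _ _ A [set i | s 0 i != 0].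
  rewrite !inE => si sj; rewrite mxE.
  under eq_bigr do rewrite !mxE rmorphM mulrACA.
  rewrite -mulr_sumr MMi; case: eqP => [<-|]; last by rewrite mulr0.
  rewrite fmorphV /= geC0_conj // -invfM -expr2.
  by rewrite -s_sqr mulVf // expf_neq0.
exists P, (W ^t*), s; split=> //; first by rewrite trmxC_unitary.
suff -> : P *m N = diag_mx s *m W by rewrite mulmxtVK.
apply/matrixP => i j; rewrite mul_diag_mx [RHS]mxE -defM.
have [si0|si0] := eqVneq (s 0 i) 0; last first.
  have WAi : row i W = row i A by apply: WA; rewrite inE.
  by have /rowP/(_ j) := WAi; rewrite !mxE => ->; rewrite mulVKf.
have di0 : d 0 i = 0 by rewrite -s_sqr si0 expr0n.
(* Row [i] of [M] has squared length 0, hence all its entries vanish. *)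
have /eqP := MMi i i; rewrite di0 mul0rn psumr_eq0; last first.
  by move=> l _; apply: mul_conjC_ge0.
move=> /allP/(_ j); rewrite mem_index_enum mul_conjC_eq0 => /(_ isT)/eqP ->.
by rewrite si0 mul0r.
Qed.

Lemma trmxCB {C : numClosedFieldType} {m n : nat} (A B : 'M[C]_(m, n)) :
  (A - B) ^t* = A ^t* - B ^t*.
Proof. by apply/matrixP => i j; rewrite !mxE rmorphB. Qed.

Lemma trmxC1 {C : numClosedFieldType} {n : nat} : (1%:M : 'M[C]_n) ^t* = 1%:M.
Proof. by rewrite trmx1 map_mx1. Qed.

(** * Identities for the defects [1 - N N^*] and [1 - N^* N] *)

Section DefectIdentities.
Context {C : numClosedFieldType} {n : nat}.
Implicit Types (A N U V P Q : 'M[C]_n) (s : 'rV[C]_n).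

Lemma defect_mul N U V :
  1%:M - (U *m N *m V) *m (U *m N *m V) ^t*
    - U *m (1%:M - N *m N ^t*) *m U ^t* =
  (1%:M - U *m U ^t*) + (U *m N) *m (1%:M - V *m V ^t*) *m (U *m N) ^t*.
Proof.
rewrite !trmxC_mul !mulmxBr !mulmxBl !mulmx1 !mulmxA.
by apply/matrixP => i j; rewrite !mxE; ring.
Qed.

(* With [B = A A^*]: [A (I - A^* A) A^* = B - B^2], and adding
   [(I - B)^2] gives [I - B]. *)
Lemma defect_trmxC A :
  1%:M - A *m A ^t* = A *m (1%:M - A ^t* *m A) *m A ^t* +
    (1%:M - A *m A ^t*) *m (1%:M - A *m A ^t*) ^t*.
Proof.
rewrite trmxCB trmxC1 trmxC_mul trmxCK.
rewrite !mulmxBr !mulmxBl !mulmx1 !mul1mx !mulmxA.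
by apply/matrixP => i j; rewrite !mxE; ring.
Qed.

Lemma trmxC_diag_ge0 s : (forall k, 0 <= s 0 k) ->
  (diag_mx s) ^t* = diag_mx s.
Proof.
move=> s_ge0; apply/matrixP => j k; rewrite !mxE eq_sym.
by case: eqP => [->|_]; rewrite ?rmorph0 // !mulr1n geC0_conj.
Qed.

(** Substituting [N = P^* Sigma Q^*], one unitary factor cancels in each product, so both defects
    have the same diagonal form [1 - Sigma^2], in the bases given by [P] and [Q]. *)
Lemma defect_svd N P Q s : P \is unitarymx -> Q \is unitarymx ->
  (forall k, 0 <= s 0 k) -> P *m N *m Q = diag_mx s ->
  let f := \row_k (1 - s 0 k ^+ 2) in
  1%:M - N *m N ^t* = P ^t* *m diag_mx f *m P /\
  1%:M - N ^t* *m N = Q *m diag_mx f *m Q ^t*.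
Proof.
move=> unitP unitQ s_ge0 svdN f.
have unitP' := mulmx1C (unitarymxP unitP).
have unitQ' := mulmx1C (unitarymxP unitQ).
have defN : N = P ^t* *m diag_mx s *m Q ^t*.
  by rewrite -svdN !mulmxA unitP' mul1mx mulmxtVK.
have defNC : N ^t* = Q *m diag_mx s *m P.
  by rewrite defN !trmxC_mul !trmxCK mulmxA trmxC_diag_ge0.
have <- : 1%:M - diag_mx s *m diag_mx s = diag_mx f.
  by rewrite mulmx_diag; apply/matrixP => j k; rewrite !mxE mulrnBl expr2.
rewrite defNC defN !mulmxBr !mulmxBl !mulmx1 unitP' (unitarymxP unitQ) !mulmxA.
by rewrite mulmxtVK // -(mulmxA _ (Q ^t*) Q) unitQ' mulmx1.
Qed.

End DefectIdentities.

(** * Sesquilinear forms and positivity of defects *)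

Section Sform.
Context {R : realType} {n : nat}.
Implicit Types (A B N U V : 'M[R[i]]_n) (x y : 'cV[R[i]]_n).

Lemma sformD A B x y : sform (A + B) x y = sform A x y + sform B x y.
Proof. by rewrite /sform mulmxDr mulmxDl mxE. Qed.

Lemma sformN A x y : sform (- A) x y = - sform A x y.
Proof. by rewrite /sform mulmxN mulNmx mxE. Qed.

Lemma sformB A B x y : sform (A - B) x y = sform A x y - sform B x y.
Proof. by rewrite sformD sformN. Qed.

Lemma sformZ a A x y : sform (a *: A) x y = a * sform A x y.
Proof. by rewrite /sform -scalemxAr -scalemxAl mxE. Qed.

Lemma sform_mul U A V x y :
  sform (U *m A *m V) x y = sform A (U ^t* *m x) (V *m y).
Proof. by rewrite /sform trmxC_mul trmxCK !mulmxA. Qed.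

Lemma sform_diag (d : 'rV[R[i]]_n) x :
  sform (diag_mx d) x x = \sum_k d 0 k * `|x k 0| ^+ 2.
Proof.
rewrite /sform -mulmxA mul_diag_mx mxE; apply: eq_bigr => k _.
by rewrite !mxE normCK mulrCA [_ * x k 0]mulrC.
Qed.

Lemma sform_mul_trmxC_ge0 A x : 0 <= sform (A *m A ^t*) x x.
Proof.
have -> : A *m A ^t* = A *m 1%:M *m A ^t* by rewrite mulmx1.
rewrite sform_mul -diag_const_mx sform_diag sumr_ge0 // => k _.
by rewrite mxE mul1r exprn_ge0.
Qed.

Lemma hermsymmx_subC A : 1%:M - A *m A ^t* \is hermsymmx.
Proof.
apply/hermsymmxP.
by rewrite trmxCB trmxC1 trmxC_mul trmxCK.
Qed.

Lemma hermsymmx_symmetrization A : 1%:M - symmetrization A \is hermsymmx.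
Proof.
apply/hermsymmxP; rewrite /symmetrization.
rewrite trmxCB trmxC1; congr (_ - _); apply/matrixP => i j.
by rewrite !mxE rmorphM rmorphD /= conjCK fmorphV rmorph_nat addrC.
Qed.

Lemma psdmx1 : psdmx (1%:M : 'M[R[i]]_n).
Proof.
split=> [|x]; first exact: hermitian1mx_subproof.
by have := sform_mul_trmxC_ge0 1%:M x; rewrite trmxC1 mulmx1.
Qed.

Lemma sform_defect_le N x :
  sform (1%:M - N *m N ^t*) x x <= 2 * sform (1%:M - symmetrization N) x x.
Proof.
rewrite -subr_ge0 -sformZ -sformB.
suff -> : 2 *: (1%:M - symmetrization N) - (1%:M - N *m N ^t*) =
  (1%:M - N) *m (1%:M - N) ^t* by apply: sform_mul_trmxC_ge0.
rewrite trmxCB trmxC1 mulmxBl !mulmxBr !mul1mx mulmx1.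
rewrite /symmetrization scalerBr scalerA divff ?pnatr_eq0 // scale1r.
by apply/matrixP => i j; rewrite !mxE; ring.
Qed.

Lemma sform_defect_mul_ge0 U N V x :
  (forall y, 0 <= sform (1%:M - U *m U ^t*) y y) ->
  (forall y, 0 <= sform (1%:M - V *m V ^t*) y y) ->
  sform (1%:M - N *m N ^t*) (U ^t* *m x) (U ^t* *m x) <=
  sform (1%:M - (U *m N *m V) *m (U *m N *m V) ^t*) x x.
Proof.
move=> psdU psdV; rewrite -sform_mul -subr_ge0 -sformB defect_mul.
by rewrite sformD sform_mul; exact: addr_ge0 (psdU _) (psdV _).
Qed.

(** Needed because a norm bound controls [A^* A], while the defect of a product involves [U U^*] and
    [V V^*]. *)
Lemma sform_defect_trmxC A :
  (forall x, 0 <= sform (1%:M - A ^t* *m A) x x) ->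
  forall x, 0 <= sform (1%:M - A *m A ^t*) x x.
Proof.
move=> psdA x; rewrite defect_trmxC sformD sform_mul.
by apply: addr_ge0; last exact: sform_mul_trmxC_ge0.
Qed.

(** * Euclidean norm and spectral norm *)

Lemma vnorm2_sqr x : ((vnorm2 x ^+ 2)%:C)%C = sform 1%:M x x.
Proof.
rewrite /vnorm2 sqr_sqrtr; last by apply: sumr_ge0 => k _; rewrite sqr_ge0.
rewrite rmorph_sum -diag_const_mx sform_diag; apply: eq_bigr => k _.
by rewrite mxE mul1r rmorphXn.
Qed.

Lemma vnorm2_ge0 x : 0 <= vnorm2 x.
Proof. exact: sqrtr_ge0. Qed.

Lemma vnorm2Z (a : R) x : 0 <= a -> vnorm2 (a%:C%C *: x) = a * vnorm2 x.
Proof.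
move=> a_ge0; rewrite /vnorm2 -[in RHS](ger0_norm a_ge0) -sqrtr_sqr.
rewrite -sqrtrM ?sqr_ge0 // mulr_sumr; congr (Num.sqrt _).
apply: eq_bigr => k _; rewrite mxE ComplexField.Normc.normcM exprMn.
by congr (_ * _); rewrite /= expr0n addr0 sqr_sqrtr ?sqr_ge0.
Qed.

Lemma entry_le_vnorm2 x k : ComplexField.Normc.normc (x k 0) <= vnorm2 x.
Proof.
rewrite -[leLHS]ger0_norm; last by case: (x k 0) => a b; apply: sqrtr_ge0.
rewrite -sqrtr_sqr ler_wsqrtr // (bigD1 k) //= lerDl sumr_ge0 // => l _.
exact: sqr_ge0.
Qed.

(** A crude row-sum bound, from the triangle inequality in each coordinate. It ensures that the
    supremum defining [spectral_norm] is a true upper bound. *)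
Lemma vnorm2_mul_bounded A :
  exists M : R, forall x, vnorm2 x <= 1 -> vnorm2 (A *m x) <= M.
Proof.
pose rowsum j : R := \sum_k ComplexField.Normc.normc (A j k).
exists (Num.sqrt (\sum_j rowsum j ^+ 2)) => x x_le1.
have normc_ge0 (z : R[i]) : 0 <= ComplexField.Normc.normc z.
  by case: z => a b; apply: sqrtr_ge0.
apply/ler_wsqrtr/ler_sum => j _; rewrite lerXn2r ?nnegrE ?sumr_ge0 //.
rewrite mxE; apply: (big_ind2 (fun u v => ComplexField.Normc.normc u <= v)).
- by rewrite ComplexField.Normc.normc0.
- move=> u1 v1 u2 v2 le1 le2.
  exact: le_trans (le_normcD _ _) (lerD le1 le2).
- move=> k _; rewrite ComplexField.Normc.normcM ler_piMr //.
  exact: le_trans (entry_le_vnorm2 x k) x_le1.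
Qed.

Lemma vnorm2_mul_le U x : spectral_norm U <= 1 -> vnorm2 (U *m x) <= vnorm2 x.
Proof.
move=> U_le1; have [x0|x_neq0] := eqVneq (vnorm2 x) 0.
  suff -> : x = 0 by rewrite mulmx0.
  apply/colP => k; rewrite mxE; apply: ComplexField.Normc.eq0_normc.
  apply/le_anti; rewrite -{1}x0 entry_le_vnorm2 /=.
  by case: (x k 0) => a b; apply: sqrtr_ge0.
have x_gt0 : 0 < vnorm2 x by rewrite lt_def x_neq0 vnorm2_ge0.
(* Rescaling to the unit sphere, where the supremum bounds the norm of [U *m y]. *)
pose y := ((vnorm2 x)^-1)%:C%C *: x.
have y1 : vnorm2 y = 1 by rewrite vnorm2Z ?invr_ge0 ?vnorm2_ge0 // mulVf.
have : vnorm2 (U *m y) <= 1.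
  apply: le_trans U_le1; apply: ub_le_sup.
    have [M M_ub] := vnorm2_mul_bounded U.
    by exists M => _ [z z_le1 <-]; apply: M_ub.
  by exists y => //=; rewrite y1.
rewrite -scalemxAr vnorm2Z ?invr_ge0 ?vnorm2_ge0 //.
by rewrite mulrC ler_pdivrMr // mul1r.
Qed.

Lemma sform_spectral_defect_ge0 U : spectral_norm U <= 1 ->
  forall x, 0 <= sform (1%:M - U ^t* *m U) x x.
Proof.
move=> U_le1 x; rewrite sformB subr_ge0.
have -> : U ^t* *m U = U ^t* *m 1%:M *m U by rewrite mulmx1.
rewrite sform_mul trmxCK -!vnorm2_sqr lecR lerXn2r ?nnegrE ?vnorm2_ge0 //.
exact: vnorm2_mul_le.
Qed.

End Sform.

(** * Passing between standard and normalized approximation *)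

Section Approximation.
Context {R : realType} {n : nat}.
Implicit Types (N Nt U V : 'M[R[i]]_n).

Lemma psdmx_defect N :
  (forall x, 0 <= sform (1%:M - N *m N ^t*) x x) -> psdmx (1%:M - N *m N ^t*).
Proof. by split; first exact: hermsymmx_subC. Qed.

Lemma psdmx_defectC N : (forall x, 0 <= sform (1%:M - N ^t* *m N) x x) ->
  psdmx (1%:M - N ^t* *m N).
Proof. by have := psdmx_defect (N ^t*); rewrite trmxCK. Qed.

Lemma symmetrization_trmxC N : symmetrization (N ^t*) = symmetrization N.
Proof. by rewrite /symmetrization trmxCK addrC. Qed.

Lemma symmetrization_diag (s : 'rV[R[i]]_n) : (forall k, 0 <= s 0 k) ->
  symmetrization (diag_mx s) = diag_mx s.
Proof.
move=> s_ge0; rewrite /symmetrization (trmxC_diag_ge0 _ s_ge0).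
have two_halves : 2^-1 + 2^-1 = 1 :> R[i] by field.
by rewrite scalerDr -scalerDl two_halves scale1r.
Qed.

Lemma normalized_SV_approx_of_standard (eps : R) N Nt : 0 <= eps ->
  (forall U V, U \is unitarymx -> V \is unitarymx ->
    standard_approx (eps / 2) 1%:M (U *m Nt *m V) (U *m N *m V)) ->
  normalized_SV_approx eps Nt N.
Proof.
move=> eps_ge0 H.
have [P [Q [s [unitP unitQ s_ge0 svdN]]]] := singular_value_decomposition N.
have [_] := H P Q unitP unitQ.
rewrite svdN (symmetrization_diag _ s_ge0).
pose e : 'rV[R[i]]_n := \row_k (1 - s 0 k).
pose f : 'rV[R[i]]_n := \row_k (1 - s 0 k ^+ 2).
have -> : 1%:M - diag_mx s = diag_mx e.
  by apply/matrixP => j k; rewrite !mxE mulrnBl.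
move=> [_ psd_e] bound.
(* Testing on a basis vector reads off a diagonal entry. *)
have e_ge0 k : 0 <= e 0 k.
  have := psd_e (delta_mx k 0); rewrite sform_diag (bigD1 k) //= big1.
    by rewrite [delta_mx _ _ _ _]mxE !eqxx normr1 expr1n mulr1 addr0.
  by move=> l /negPf lk; rewrite [delta_mx _ _ _ _]mxE lk normr0 expr0n mulr0.
(* From [0 <= s 0 k <= 1] follows [s 0 k ^+ 2 <= s 0 k]. *)
have le_ef k : e 0 k <= f 0 k.
  have := e_ge0 k; rewrite !mxE => e_ge0k.
  by rewrite lerD2l lerN2 expr2 ler_piMr // -subr_ge0.
have sform_le x : sform (diag_mx e) x x <= sform (diag_mx f) x x.
  by rewrite !sform_diag ler_sum // => k _; rewrite ler_wpM2r ?exprn_ge0.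
have f_ge0 x : 0 <= sform (diag_mx f) x x by apply: le_trans (sform_le x).
have [left_defect right_defect] := defect_svd _ _ _ _ unitP unitQ s_ge0 svdN.
split.
- by apply: psdmx_defect => x; rewrite left_defect sform_mul trmxCK.
- by apply: psdmx_defectC => x; rewrite right_defect sform_mul.
move=> x y; rewrite left_defect right_defect !sform_mul trmxCK.
(* At these vectors the unitary factors cancel, leaving the form of [Nt - N] at [x] and [y]. *)
have := bound (P *m x) (Q ^t* *m y).
rewrite -svdN -mulmxBl -mulmxBr sform_mul !mulmxA.
rewrite (mulmx1C (unitarymxP unitP)) (unitarymxP unitQ) !mul1mx => /le_trans; apply.
have -> : eps / 2 / 2 = eps / 4 by field.
by rewrite ler_wpM2l ?lerD ?ler0c ?divr_ge0.
Qed.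

Lemma normalized_SV_approx_mul (eps : R) N Nt U V : 0 <= eps ->
  spectral_norm U <= 1 -> spectral_norm V <= 1 ->
  normalized_SV_approx eps Nt N ->
  normalized_SV_approx eps (U *m Nt *m V) (U *m N *m V).
Proof.
move=> eps_ge0 /sform_spectral_defect_ge0 psdU /sform_spectral_defect_ge0 psdV.
move=> [[_ psdN] [_ psdNC] bound].
have leL x := @sform_defect_mul_ge0 _ _ U N V x
  (sform_defect_trmxC _ psdU) (sform_defect_trmxC _ psdV).
have leR x : sform (1%:M - N ^t* *m N) (V *m x) (V *m x) <=
    sform (1%:M - (U *m N *m V) ^t* *m (U *m N *m V)) x x.
  (* The right defect of [U N V] is the left defect of its adjoint [V^* N^* U^*]. *)
  have := @sform_defect_mul_ge0 _ _ (V ^t*) (N ^t*) (U ^t*) x.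
  have -> : V ^t* *m N ^t* *m U ^t* = (U *m N *m V) ^t*.
    by rewrite !trmxC_mul mulmxA.
  by rewrite !trmxCK => /(_ psdV psdU).
split.
- by apply: psdmx_defect => x; apply: le_trans (leL x).
- by apply: psdmx_defectC => x; apply: le_trans (leR x).
move=> x y; rewrite -mulmxBl -mulmxBr sform_mul.
apply: le_trans (bound _ _) _.
by rewrite ler_wpM2l ?lerD ?ler0c ?divr_ge0.
Qed.

Lemma standard_approx_of_normalized_SV (eps : R) N Nt : 0 <= eps ->
  normalized_SV_approx eps Nt N -> standard_approx eps 1%:M Nt N.
Proof.
move=> eps_ge0 [[_ psdN] _ bound].
have leR y : sform (1%:M - N ^t* *m N) y y <=
    2 * sform (1%:M - symmetrization N) y y.
  by have := sform_defect_le (N ^t*) y; rewrite trmxCK symmetrization_trmxC.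
split; first exact: psdmx1.
  split=> [|x]; first exact: hermsymmx_symmetrization.
  have := le_trans (psdN x) (sform_defect_le N x).
  by rewrite pmulr_rge0.
move=> x y; apply: le_trans (bound x y) _.
(* The factor 2 lost in comparing each defect with [1 - S_N] turns [eps / 4] into [eps / 2], the
   constant of a standard [eps]-approximation. *)
have -> : ((eps / 2)%:C = (eps / 4)%:C * 2)%C.
  by rewrite -(rmorph_nat (real_complex R)) -rmorphM; congr (_%:C)%C; field.
rewrite -mulrA ler_wpM2l ?ler0c ?divr_ge0 //.
by rewrite mulrDr; exact: lerD (sform_defect_le N x) (leR y).
Qed.

End Approximation.

Theorem mainTheorem7 (R : realType) (n : nat) (eps : R) (heps : 0 <= eps)
    (N Nt : 'M[R[i]]_n) :
  ((forall U V : 'M[R[i]]_n, U \is unitarymx -> V \is unitarymx ->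
      standard_approx (eps / 2) 1%:M (U *m Nt *m V) (U *m N *m V)) ->
   normalized_SV_approx eps Nt N) /\
  (normalized_SV_approx eps Nt N ->
   forall U V : 'M[R[i]]_n, spectral_norm U <= 1 -> spectral_norm V <= 1 ->
     normalized_SV_approx eps (U *m Nt *m V) (U *m N *m V) /\
     standard_approx eps 1%:M (U *m Nt *m V) (U *m N *m V)).
Proof.
split; first exact: normalized_SV_approx_of_standard.
move=> approxN U V U_le1 V_le1.
have approxUNV := normalized_SV_approx_mul _ _ _ _ _ heps U_le1 V_le1 approxN.
by split; last exact: standard_approx_of_normalized_SV.
Qed.
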